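(* Let $L\subseteq\mathcal{L}$ be a finite signature and $i\in\mathbb{I}(L)$. Then $\sigma_{o|L}(i)\subseteq\sigma_{|L}(i)$.
   Context: Fix a universe $\mathcal{L}$ of lifelines and a universe $\mathcal{M}$ of messages. For $l\in\mathcal{L}$, $\mathbb{A}_l=\{l!m,\ l?m\mid m\in\mathcal{M}\}$ with $\theta(a)=l$ for $a\in\mathbb{A}_l$, and $\mathbb{T}_l=\mathbb{A}_l^*$. Multi-traces: for finite $L$, $\mathbb{A}(L)=\bigcup_{l\in L}\mathbb{A}_l$ and $\mathbb{M}(L)=\prod_{l\in L}\mathbb{T}_l$, with empty multi-trace $\varepsilon_L$. The multi-trace $a\,\hat{}\,\mu$ is $\mu$ with its $\theta(a)$-component $t$ replaced by $a.t$. Operations on multi-traces: - $\mu_1\cup\mu_2=\{\mu_1,\mu_2\}$. - $\mu_1;\mu_2$ is the componentwise concatenation. - $\mu_1\,||\,\mu_2$ is the set of componentwise shuffles of $\mu_1$ and $\mu_2$. These are extended to sets via unions over pairs. For $\diamond\in\{;,||\}$, $T^{\diamond*}=\bigcup_{j\ge0}T^{\diamond j}$, with $T^{\diamond0}=\{\varepsilon_L\}$ and $T^{\diamond j}=T\diamond T^{\diamond(j-1)}$. Interactions: $\mathbb{I}(L)$ is the set of ground terms built from $\varnothing$, actions $a\in\mathbb{A}(L)$, the unary operators $loop_S,loop_P$ and the binary operators $seq,par,alt$. Denotational semantics $\sigma_{|L}$: - $\sigma_{|L}(\varnothing)=\{\varepsilon_L\}$ and $\sigma_{|L}(a)=\{a\,\hat{}\,\varepsilon_L\}$;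 - $seq$, $par$, $alt$ are interpreted by $;$, $||$, $\cup$; - $loop_S$, $loop_P$ are interpreted by ${}^{;*}$, ${}^{||*}$. Termination predicate $\downarrow$: it is the smallest predicate such that - $\varnothing\downarrow$; - $loop_k(i_1)\downarrow$; - $alt(i_1,i_2)\downarrow$ if $i_1\downarrow$ or $i_2\downarrow$; - $seq(i_1,i_2)\downarrow$ and $par(i_1,i_2)\downarrow$ if both $i_1\downarrow$ and $i_2\downarrow$. Execution relation $\rightarrow$: it is the smallest relation such that - $a\xrightarrow{a}\varnothing$; - if $i_1\xrightarrow{a}i_1'$, then $alt(i_1,i_2)\xrightarrow{a}i_1'$, $par(i_1,i_2)\xrightarrow{a}par(i_1',i_2)$, $seq(i_1,i_2)\xrightarrow{a}seq(i_1',i_2)$, $loop_S(i_1)\xrightarrow{a}seq(i_1',loop_S(i_1))$ and $loop_P(i_1)\xrightarrow{a}par(i_1',loop_P(i_1))$; - if $i_2\xrightarrow{a}i_2'$, then $alt(i_1,i_2)\xrightarrow{a}i_2'$ and $par(i_1,i_2)\xrightarrow{a}par(i_1,i_2')$; - if $i_2\xrightarrow{a}i_2'$ and $i_1\downarrow$, then $seq(i_1,i_2)\xrightarrow{a}i_2'$. Operational semantics $\sigma_{o|L}:\mathbb{I}(L)\to\mathcal{P}(\mathbb{M}(L))$: it is the least family of sets such that - if $i\downarrow$ then $\varepsilon_L\in\sigma_{o|L}(i)$; - if $\mu\in\sigma_{o|L}(i')$ and $i\xrightarrow{a}i'$, then $a\,\hat{}\,\mu\in\sigma_{o|L}(i)$.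 *)

(* Defs.v *)
From mathcomp Require Import all_boot finmap classical_sets.

Set Implicit Arguments.
Unset Strict Implicit.
Unset Printing Implicit Defensive.

Local Open Scope classical_set_scope.

(* The universe of lifelines is an arbitrary choiceType [Lf] (the structure
   needed to speak of finite subsets [{fset Lf}]); messages are an arbitrary
   type. *)

Section Actions.
Variables (Lf : choiceType) (M : Type).

(* [Send l m] is l!m and [Receive l m] is l?m. *)
Inductive local_action (l : Lf) : Type :=
| Send of M
| Receive of M.

Definition trace (l : Lf) : Type := seq (local_action l).

(* A(L) is the union of the A_l for l in L, which is disjoint. *)
Definition action (L : {fset Lf}) : Type := {l : L & local_action (val l)}.

Definition theta (L : {fset Lf}) (a : action L) : L := tag a.

Definition multitrace (L : {fset Lf}) : Type :=
  {dffun forall l : L, trace (val l)}.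

End Actions.

Inductive shuffle (T : Type) : seq T -> seq T -> seq T -> Prop :=
| shuffle_nil : shuffle [::] [::] [::]
| shuffle_left x s1 s2 s : shuffle s1 s2 s -> shuffle (x :: s1) s2 (x :: s)
| shuffle_right x s1 s2 s : shuffle s1 s2 s -> shuffle s1 (x :: s2) (x :: s).

Section Multitraces.
Variables (Lf : choiceType) (M : Type) (L : {fset Lf}).
Local Notation MT := (multitrace M L).
Implicit Types (mu : MT) (T : set MT).

Definition mt_empty : MT := [ffun l : L => [::] : trace M (val l)].

Definition mt_cons (a : action M L) mu : MT :=
  [ffun l : L =>
     dfwith (fun k : L => mu k : trace M (val k))
            (tagged a :: mu (theta a) : trace M (val (theta a))) l].

Definition mt_alt mu1 mu2 : set MT := [set mu1; mu2].

Definition mt_seq mu1 mu2 : set MT :=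
  [set [ffun l : L => (mu1 l ++ mu2 l) : trace M (val l)] : MT].

Definition mt_par mu1 mu2 : set MT :=
  [set mu | forall l : L, shuffle (mu1 l) (mu2 l) (mu l)].

(* Union over pairs; for [mt_alt] this is the union of T1 and T2 only when both
   are nonempty, which always holds for the semantics below. *)
Definition lift_op (op : MT -> MT -> set MT) T1 T2 : set MT :=
  \bigcup_(p in T1 `*` T2) op p.1 p.2.

Definition op_iter (op : MT -> MT -> set MT) T (j : nat) : set MT :=
  iter j (lift_op op T) [set mt_empty].

Definition kleene (op : MT -> MT -> set MT) T : set MT :=
  \bigcup_j op_iter op T j.

End Multitraces.

Section Interactions.
Variables (Lf : choiceType) (M : Type) (L : {fset Lf}).

Inductive interaction : Type :=
| IEmpty
| IAct of action M L
| ILoopS of interaction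
| ILoopP of interaction
| ISeq of interaction & interaction
| IPar of interaction & interaction
| IAlt of interaction & interaction.

Fixpoint den_sem (i : interaction) : set (multitrace M L) :=
  match i with
  | IEmpty => [set mt_empty M L]
  | IAct a => [set mt_cons a (mt_empty M L)]
  | ILoopS i1 => kleene (@mt_seq _ M L) (den_sem i1)
  | ILoopP i1 => kleene (@mt_par _ M L) (den_sem i1)
  | ISeq i1 i2 => lift_op (@mt_seq _ M L) (den_sem i1) (den_sem i2)
  | IPar i1 i2 => lift_op (@mt_par _ M L) (den_sem i1) (den_sem i2)
  | IAlt i1 i2 => lift_op (@mt_alt _ M L) (den_sem i1) (den_sem i2)
  end.

Inductive terminates : interaction -> Prop :=
| term_empty : terminates IEmpty
| term_loopS i1 : terminates (ILoopS i1)
| term_loopP i1 : terminates (ILoopP i1)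
| term_altl i1 i2 : terminates i1 -> terminates (IAlt i1 i2)
| term_altr i1 i2 : terminates i2 -> terminates (IAlt i1 i2)
| term_seq i1 i2 : terminates i1 -> terminates i2 -> terminates (ISeq i1 i2)
| term_par i1 i2 : terminates i1 -> terminates i2 -> terminates (IPar i1 i2).

Inductive exec : interaction -> action M L -> interaction -> Prop :=
| exec_act a : exec (IAct a) a IEmpty
| exec_altl i1 i2 a i1' : exec i1 a i1' -> exec (IAlt i1 i2) a i1'
| exec_parl i1 i2 a i1' : exec i1 a i1' -> exec (IPar i1 i2) a (IPar i1' i2)
| exec_seql i1 i2 a i1' : exec i1 a i1' -> exec (ISeq i1 i2) a (ISeq i1' i2)
| exec_loopS i1 a i1' :
    exec i1 a i1' -> exec (ILoopS i1) a (ISeq i1' (ILoopS i1))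
| exec_loopP i1 a i1' :
    exec i1 a i1' -> exec (ILoopP i1) a (IPar i1' (ILoopP i1))
| exec_altr i1 i2 a i2' : exec i2 a i2' -> exec (IAlt i1 i2) a i2'
| exec_parr i1 i2 a i2' : exec i2 a i2' -> exec (IPar i1 i2) a (IPar i1 i2')
| exec_seqr i1 i2 a i2' :
    exec i2 a i2' -> terminates i1 -> exec (ISeq i1 i2) a i2'.

Inductive op_sem : interaction -> multitrace M L -> Prop :=
| op_sem_empty i : terminates i -> op_sem i (mt_empty M L)
| op_sem_step i a i' mu :
    op_sem i' mu -> exec i a i' -> op_sem i (mt_cons a mu).

End Interactions.

(* Main.v *)
Require Import Defs.
From mathcomp Require Import all_boot finmap classical_sets.

Local Open Scope classical_set_scope.

(** Soundness reduces to two closure properties of the denotational semantics: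
    a terminating interaction denotes the empty multi-trace, and if
    [i -a-> i'] then prefixing [a] maps the denotation of [i'] into that of
    [i]. The second holds because prefixing the left operand of a
    concatenation, or either operand of a shuffle, prefixes the result. *)

Section Soundness.
Variables (Lf : choiceType) (M : Type) (L : {fset Lf}).
Implicit Types (a : action M L) (mu : multitrace M L) (i : interaction M L).
Implicit Types (T : set (multitrace M L)).

Lemma mt_cons_theta a mu :
  mt_cons a mu (theta a) = tagged a :: mu (theta a).
Proof. by rewrite ffunE dfwith_in. Qed.

Lemma mt_cons_neq a mu (l : L) : theta a != l -> mt_cons a mu l = mu l.
Proof. by move=> al; rewrite ffunE dfwith_out. Qed.

Lemma mt_seq_emptyl mu : mt_seq (mt_empty M L) mu mu.
Proof. by apply/ffunP => l; rewrite !ffunE. Qed.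

Lemma mt_seq_cons a mu1 mu2 mu :
  mt_seq mu1 mu2 mu -> mt_seq (mt_cons a mu1) mu2 (mt_cons a mu).
Proof.
move=> ->; apply/ffunP => l; have [<-|al] := eqVneq (theta a) l.
  by rewrite mt_cons_theta !ffunE dfwith_in.
by rewrite mt_cons_neq // !ffunE dfwith_out.
Qed.

Lemma mt_par_empty : mt_par (mt_empty M L) (mt_empty M L) (mt_empty M L).
Proof. by move=> l; rewrite ffunE; apply: shuffle_nil. Qed.

Lemma mt_par_consl a mu1 mu2 mu :
  mt_par mu1 mu2 mu -> mt_par (mt_cons a mu1) mu2 (mt_cons a mu).
Proof.
move=> sh l; have [<-|al] := eqVneq (theta a) l.
  by rewrite !mt_cons_theta; apply/shuffle_left/sh.
by rewrite !mt_cons_neq //; apply: sh.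
Qed.

Lemma mt_par_consr a mu1 mu2 mu :
  mt_par mu1 mu2 mu -> mt_par mu1 (mt_cons a mu2) (mt_cons a mu).
Proof.
move=> sh l; have [<-|al] := eqVneq (theta a) l.
  by rewrite !mt_cons_theta; apply/shuffle_right/sh.
by rewrite !mt_cons_neq //; apply: sh.
Qed.

Lemma lift_opI op T1 T2 mu1 mu2 mu :
  T1 mu1 -> T2 mu2 -> op mu1 mu2 mu -> lift_op op T1 T2 mu.
Proof. by move=> T1mu1 T2mu2 opmu; exists (mu1, mu2). Qed.

Lemma kleene_empty op T : kleene op T (mt_empty M L).
Proof. by exists 0. Qed.

(** The [j] iterations behind [mu2] become [j.+1]: [op_iter] adds each new factor on the left, the
    side on which [exec] unfolds a loop. *)
Lemma kleene_step op T mu1 mu2 mu :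
  T mu1 -> kleene op T mu2 -> op mu1 mu2 mu -> kleene op T mu.
Proof.
by move=> Tmu1 [j _ Tjmu2] opmu; exists j.+1 => //; apply: lift_opI Tjmu2 opmu.
Qed.

Lemma den_sem_nonempty i : den_sem i !=set0.
Proof.
elim: i => [|a|i1 _|i1 _|i1 [m1 h1] i2 [m2 h2]|i1 [m1 h1] i2 [m2 h2]
           |i1 [m1 h1] i2 [m2 h2]] /=.
- by exists (mt_empty M L).
- by exists (mt_cons a (mt_empty M L)).
- by exists (mt_empty M L); apply: kleene_empty.
- by exists (mt_empty M L); apply: kleene_empty.
- by eexists; apply: lift_opI h1 h2 _.
(* Concatenation is one particular shuffle on each lifeline: all of [m1 l], then all of [m2 l]. *)
- exists [ffun l : L => (m1 l ++ m2 l) : trace M (val l)].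
  apply: lift_opI h1 h2 _ => l; rewrite ffunE.
  elim: (m1 l) => [|x s IHs]; last exact: shuffle_left.
  by elim: (m2 l) => [|x s IHs]; [apply: shuffle_nil | apply: shuffle_right].
- by exists m1; apply: lift_opI h1 h2 _; left.
Qed.

(* Nonemptiness of the other branch matters: [lift_op] takes unions over pairs,
   so it would be empty if either argument were. *)
Lemma den_sem_alt i1 i2 : den_sem (IAlt i1 i2) = den_sem i1 `|` den_sem i2.
Proof.
have [[m1 h1] [m2 h2]] := (den_sem_nonempty i1, den_sem_nonempty i2).
apply/seteqP; split=> mu.
  by case=> -[n1 n2] [/= k1 k2] [->|->]; [left | right].
case=> h; first by apply: lift_opI h h2 _; left.
by apply: lift_opI h1 h _; right.
Qed.

Lemma den_sem_terminates i : terminates i -> den_sem i (mt_empty M L).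
Proof.
elim=> {i} [|i1|i1|i1 i2 _ h|i1 i2 _ h|i1 i2 _ h1 _ h2|i1 i2 _ h1 _ h2] //.
(* Either kind of loop may run zero times. *)
- exact: kleene_empty.
- exact: kleene_empty.
- by rewrite den_sem_alt; left.
- by rewrite den_sem_alt; right.
- exact: lift_opI h1 h2 (mt_seq_emptyl _).
- exact: lift_opI h1 h2 mt_par_empty.
Qed.

(** Induction on the execution step, with [mu] general: under [par], [seq] and the loops, the
    hypothesis is applied to a component of [mu]. *)
Lemma den_sem_exec i a i' mu :
  exec i a i' -> den_sem i' mu -> den_sem i (mt_cons a mu).
Proof.
move=> ex; elim: ex mu => {i a i'}
  [a|i1 i2 a i1' _ IH|i1 i2 a i1' _ IH|i1 i2 a i1' _ IH|i1 a i1' _ IH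
  |i1 a i1' _ IH|i1 i2 a i2' _ IH|i1 i2 a i2' _ IH|i1 i2 a i2' _ IH ter] mu.
- by move=> ->.
- by rewrite den_sem_alt => /IH; left.
- by case=> -[m1 m2] [/= /IH h1 h2] /(mt_par_consl a); apply: lift_opI h1 h2.
- by case=> -[m1 m2] [/= /IH h1 h2] /(mt_seq_cons a); apply: lift_opI h1 h2.
(* Prefixing [a] to the part [m1] from [i1'] completes a first iteration of [i1]; [m2] holds the
   remaining iterations. *)
- by case=> -[m1 m2] [/= /IH h1 h2] /(mt_seq_cons a); apply: kleene_step h1 h2.
- by case=> -[m1 m2] [/= /IH h1 h2] /(mt_par_consl a); apply: kleene_step h1 h2.
- by rewrite den_sem_alt => /IH; right.
- by case=> -[m1 m2] [/= h1 /IH h2] /(mt_par_consr a); apply: lift_opI h1 h2.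
(* The skipped [i1] contributes the empty multi-trace, a left unit for concatenation. *)
- move=> /IH h2; have h1 := den_sem_terminates _ ter.
  exact: lift_opI h1 h2 (mt_seq_emptyl _).
Qed.

End Soundness.

Theorem theorem3 (Lf : choiceType) (M : Type) (L : {fset Lf})
    (i : interaction M L) :
  op_sem i `<=` den_sem i.
Proof.
move=> mu; elim=> {i mu} [i|i a i' mu _ IH ex]; first exact: den_sem_terminates.
exact: den_sem_exec ex IH.
Qed.
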